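(* Let $d\geq 4$ be even. For $p,q,r\in\mathbb{R}$ with $p\neq 0$, the real fibre of $G_d\colon\mathbb{R}^3\to\mathbb{R}^3$ over $(p,q,r)$ is non-empty if and only if $r>\beta_d(p,q)$. Consequently $$G_d(\mathbb{R}^3)=\{(p,q,r)\in\mathbb{R}^3: p=0\}\cup\{(p,q,r)\in\mathbb{R}^3: p\neq 0,\ r>\beta_d(p,q)\},$$ and the set $\Theta_d:=\mathbb{R}^3\setminus G_d(\mathbb{R}^3)=\{(p,q,r): p\neq 0,\ r\leq\beta_d(p,q)\}$ is unbounded, has non-empty interior, contains a downward vertical ray (of the form $\{(p,q,r): r\leq r_0\}$ with $p,q$ fixed) over every $(p,q)$ with $p\neq 0$, and is closed in $\mathbb{R}^3$.
   Context: Put $A=1+xy$, $B=A^2z+y^2(4+3xy)$, $P=AB$, $Q=y+3xB$, $R=2x-3x^2y-x^3z$. For even $d\geq 4$, $G_d=(P,Q_d,R_d)\colon\mathbb{R}^3\to\mathbb{R}^3$ with $Q_d=Q+A^2x^{d-2}B^d$ and $R_d=R-\frac{d-2}{d}x^dB^d$. For real $p\neq 0$ and $q\in\mathbb{R}$ let $f_{p,q}(s)=\frac{2}{d}p^ds^d+2ps^3-qs^2+2s$, a polynomial of even degree $d$ in $s$ with positive leading coefficient, and put $\beta_d(p,q):=\min_{s\in\mathbb{R}}f_{p,q}(s)$. *)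

(* Defs.v *)
From HB Require Import structures.
From mathcomp Require Import all_boot all_order all_algebra.
From mathcomp Require Import all_classical all_reals all_analysis.
From mathcomp Require Import ring lra.
Set Implicit Arguments.
Unset Strict Implicit.
Unset Printing Implicit Defensive.
Import Order.TTheory GRing.Theory Num.Theory.
Import numFieldNormedType.Exports.
Local Open Scope classical_set_scope.
Local Open Scope ring_scope.

(* MathComp-Analysis.  Real 3-space is the product R * R * R, with the product
   topology and the max norm. *)

Section Defs.
Variable R : realType.
Implicit Types (x y z p q r s m : R) (d : nat).

Definition polyA x y : R := 1 + x * y.

Definition polyB x y z : R :=
  polyA x y ^+ 2 * z + y ^+ 2 * (4 + 3 * x * y).

Definition polyP x y z : R := polyA x y * polyB x y z.

Definition polyQ x y z : R := y + 3 * x * polyB x y z.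

Definition polyR x y z : R := 2 * x - 3 * x ^+ 2 * y - x ^+ 3 * z.

Definition polyQd d x y z : R :=
  polyQ x y z + polyA x y ^+ 2 * x ^+ (d - 2) * polyB x y z ^+ d.

Definition polyRd d x y z : R :=
  polyR x y z - (d%:R - 2) / d%:R * x ^+ d * polyB x y z ^+ d.

Definition G d (v : R * R * R) : R * R * R :=
  let: (x, y, z) := v in (polyP x y z, polyQd d x y z, polyRd d x y z).

Definition f d p q s : R :=
  2 / d%:R * p ^+ d * s ^+ d + 2 * p * s ^+ 3 - q * s ^+ 2 + 2 * s.

(* [beta d p q] is the least value of [f d p q] on the whole line; it is a
   genuine minimum when p != 0 and d >= 4 is even (lemma [beta_min]) and has
   no meaning otherwise. *)
Definition beta d p q : R :=
  get [set m | range (f d p q) m /\ lbound (range (f d p q)) m].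

Definition Theta d : set (R * R * R) := ~` range (G d).

Lemma f_has_min d p q : (4 <= d)%N -> ~~ odd d -> p != 0 ->
  exists s, forall t, f d p q s <= f d p q t.
Proof.
move=> d4 dev p0.
have d0 : (0 : R) < d%:R by rewrite ltr0n (leq_trans _ d4).
pose c := 2 / d%:R * p ^+ d.
have c0 : 0 < c.
  by rewrite mulr_gt0 ?divr_gt0 // lt0r expf_neq0 //= exprn_even_ge0.
pose K := 2 * `|p| + `|q| + 2.
have K0 : 0 < K by rewrite /K ltr_wpDl // addr_ge0 // mulr_ge0.
pose M := 1 + K / c.
have M1 : 1 <= M by rewrite lerDl divr_ge0 // ltW.
have fM t : M <= `|t| -> 0 <= f d p q t.
  move=> Mt; set a := `|t| in Mt *.
  have a1 : 1 <= a := le_trans M1 Mt.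
  have a0 : 0 <= a := le_trans ler01 a1.
  have Kca : K <= c * a.
    have : c * M <= c * a by rewrite ler_pM2l.
    rewrite /M mulrDr mulr1 mulrCA mulfV ?gt_eqF // mulr1.
    by apply: le_trans; rewrite lerDr ltW.
  have ead : t ^+ d = a ^+ d.
    by rewrite -normrX ger0_norm // exprn_even_ge0.
  have ea4 : c * a ^+ 4 <= c * a ^+ d by rewrite ler_pM2l // ler_weXn2l.
  have h3 : - (2 * `|p| * a ^+ 3) <= 2 * p * t ^+ 3.
    rewrite lerNl; apply: le_trans (ler_norm _) _.
    by rewrite normrN normrM normrX normrM ger0_norm.
  have h2 : - (`|q| * a ^+ 2) <= - (q * t ^+ 2).
    rewrite lerN2; apply: le_trans (ler_norm _) _.
    by rewrite normrM normrX.
  have h1 : - (2 * a) <= 2 * t.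
    rewrite lerNl; apply: le_trans (ler_norm _) _.
    by rewrite normrN normrM ger0_norm.
  have a23 : a ^+ 2 <= a ^+ 3 by rewrite ler_weXn2l.
  have a13 : a <= a ^+ 3 by rewrite ler_eXnr.
  have q23 : `|q| * a ^+ 2 <= `|q| * a ^+ 3 by rewrite ler_wpM2l.
  have K4 : K * a ^+ 3 <= c * a ^+ 4.
    by rewrite [a ^+ 4]exprS (mulrA c a) ler_wpM2r // exprn_ge0.
  have EK : K * a ^+ 3 = 2 * `|p| * a ^+ 3 + `|q| * a ^+ 3 + 2 * a ^+ 3.
    by rewrite /K !mulrDl.
  by rewrite /f -/c ead; lra.
have cf : {within `[- M, M], continuous (f d p q)}.
  apply: continuous_subspaceT => t; rewrite /f.
  apply: cvgD; last by apply: cvgM; [exact: cvg_cst|exact: cvg_id].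
  apply: cvgB; last by apply: cvgM; [exact: cvg_cst|exact: exprn_continuous].
  by apply: cvgD; (apply: cvgM; [exact: cvg_cst|exact: exprn_continuous]).
have NMM : - M <= M by lra.
have [s _ smin] := EVT_min NMM cf.
have f0 : f d p q 0 = 0.
  by rewrite /f !expr0n /= (gtn_eqF (leq_trans _ d4)) // !mulr0 subr0 !addr0.
exists s => t; have [Mt|tM] := leP M `|t|.
  apply: le_trans (fM _ Mt); rewrite -f0; apply: smin.
  by rewrite in_itv /=; apply/andP; split; lra.
by apply: smin; rewrite in_itv /= -ler_norml ltW.
Qed.

Lemma beta_min d p q : (4 <= d)%N -> ~~ odd d -> p != 0 ->
  (exists s, f d p q s = beta d p q) /\ (forall t, beta d p q <= f d p q t).
Proof.
move=> d4 dev p0; have [s smin] := f_has_min q d4 dev p0.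
have [] : range (f d p q) (beta d p q) /\
          lbound (range (f d p q)) (beta d p q).
  apply: (@xgetI _ _ [set m | range (f d p q) m /\ lbound (range (f d p q)) m]
    (f d p q s)).
  by split; [exists s | move=> _ [t _ <-]].
move=> [u _ fu] lb; split; first by exists u.
by move=> t; apply: lb; exists t.
Qed.

End Defs.

(* Main.v *)
(* On a fibre over p <> 0 one has A <> 0; with s = x / A the remaining two
   equations say that y is a function of s and that f_{p,q}(s) = r, while
   1 / A = f'(s) / 2.  So the fibre is non-empty iff f takes the value r at a
   noncritical point.  At r = beta every solution is critical; for r > beta
   there are solutions on both sides of a minimiser, and since f'''' >= 0 they
   cannot both be critical.  The image is open because it contains every
   (p, q, r) with r > f_{p,q}(s) for some s, and because inf f_{p,q} tends to
   minus infinity as p tends to 0. *)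

Require Import Defs.
From HB Require Import structures.
From mathcomp Require Import all_boot all_order all_algebra.
From mathcomp Require Import polyrcf.
From mathcomp Require Import all_classical all_reals all_analysis.
From mathcomp Require Import ring lra.
Import Order.TTheory GRing.Theory Num.Theory.
Import numFieldNormedType.Exports.
Local Open Scope classical_set_scope.
Local Open Scope ring_scope.

(** * Polynomials with nonnegative fourth derivative *)

(** Rolle's theorem in three rounds: four zeros of [h] leave three, two and one zeros of its
    successive derivatives. *)
Lemma deriv3_root {R : rcfType} (h : {poly R}) {a b c e : R} :
  a < b -> b < c -> c < e ->
  h.[a] = 0 -> h.[b] = 0 -> h.[c] = 0 -> h.[e] = 0 ->
  exists x, h^`()^`()^`().[x] = 0.
Proof.
have rolle (k : {poly R}) u v : u < v -> k.[u] = 0 -> k.[v] = 0 ->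
    exists w, [/\ u < w, w < v & k^`().[w] = 0].
  move=> uv ku kv; have [|w] := @poly_rolle _ _ _ k uv; first by rewrite ku kv.
  by rewrite in_itv /= => /andP[uw wv] kw; exists w.
move=> ab bc ce ha hb hc he.
have [u [_ ub hu]] := rolle _ _ _ ab ha hb.
have [v [bv vc hv]] := rolle _ _ _ bc hb hc.
have [w [cw _ hw]] := rolle _ _ _ ce hc he.
have [y [_ yv hy]] := rolle _ _ _ (lt_trans ub bv) hu hv.
have [z [vz _ hz]] := rolle _ _ _ (lt_trans vc cw) hv hw.
have [x [_ _ hx]] := rolle _ _ _ (lt_trans yv vz) hy hz.
by exists x.
Qed.

(** Otherwise F' is negative at some c between a and m. The cubic through the values of F' at a, c,
    m, b then has negative leading coefficient, against F'''' >= 0. *)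
Lemma critical_triple_le {R : rcfType} (F : {poly R}) {a m b : R} :
  (forall x, 0 <= F^`(4).[x]) -> a < m -> m < b ->
  F^`().[a] = 0 -> F^`().[m] = 0 -> F^`().[b] = 0 -> F.[a] <= F.[m].
Proof.
move=> F4 am mb Fa Fm Fb; have [c] := @poly_mvt _ _ _ F am.
rewrite in_itv /= => /andP[ac cm] Ec.
rewrite -subr_ge0 Ec pmulr_lge0 ?subr_gt0 // leNgt; apply/negP => Fc.
have D0 : 0 < (c - a) * (c - m) * (c - b).
  by rewrite -mulrA pmulr_rgt0 ?subr_gt0 // nmulr_rgt0 subr_lt0 // (lt_trans cm).
pose l := F^`().[c] / ((c - a) * (c - m) * (c - b)).
have l0 : l < 0 by rewrite /l pmulr_llt0 // invr_gt0.
(* [h] has the extra zero [c], hence four zeros, whereas its third derivative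
   [F^`(4) - 6 l] is positive. *)
pose h := F^`() - l *: (('X - a%:P) * ('X - m%:P) * ('X - b%:P)).
have hE x : h.[x] = F^`().[x] - l * ((x - a) * (x - m) * (x - b)).
  by rewrite hornerD hornerN hornerZ !hornerM !hornerXsubC.
have [|||||||x] := @deriv3_root _ h a c m b => //.
- by rewrite hE Fa; ring.
- by rewrite hE /l mulfVK ?gt_eqF // subrr.
- by rewrite hE Fm; ring.
- by rewrite hE Fb; ring.
  rewrite /h !derivB !derivZ.
  rewrite !(derivM, derivD, derivN, derivX, derivC, oppr0, addr0).
  rewrite hornerD hornerN hornerZ.
  rewrite !(hornerD, hornerM, hornerXsubC, hornerC, horner0) => Ex.
  have := F4 x; lra.
Qed.

(** * Derivatives and growth of [f], and noncritical solutions *)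

Definition fpoly {R : realType} d (p q : R) : {poly R} :=
  (2 / d%:R * p ^+ d) *: 'X^d + (2 * p) *: 'X^3 - q *: 'X^2 + 2 *: 'X.

Lemma horner_fpoly {R : realType} d (p q s : R) : (fpoly d p q).[s] = f d p q s.
Proof. by rewrite /fpoly !hornerD hornerN !hornerZ !hornerXn hornerX. Qed.

Lemma horner_deriv_fpoly {R : realType} d (p q s : R) : (0 < d)%N ->
  (fpoly d p q)^`().[s] =
    2 * (1 - q * s + 3 * p * s ^+ 2 + p ^+ d * s ^+ d.-1).
Proof.
move=> d0; have dn0 : d%:R != 0 :> R by rewrite pnatr_eq0 -lt0n.
rewrite /fpoly derivD derivB derivD !derivZ !derivXn derivX.
rewrite !hornerD hornerN !hornerZ !hornerMn !hornerXn hornerC /=.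
by rewrite -[_ *+ d]mulr_natr; field.
Qed.

(** The terms of degree at most 3 vanish, and d - 4 is even. *)
Lemma derivn4_fpoly_ge0 {R : realType} d (p q s : R) : ~~ odd d -> (4 <= d)%N ->
  0 <= (fpoly d p q)^`(4).[s].
Proof.
move=> dev d4.
have X4 n : (n < 4)%N -> ('X^n : {poly R})^`(4) = 0.
  by move=> n4; rewrite derivnXn ffact_small ?mulr0n.
rewrite /fpoly derivnD derivnB derivnD !derivnZ derivnXn !X4 //.
have X14 : ('X : {poly R})^`(4) = 0 := X4 1%N isT.
rewrite X14 !scaler0 subr0 !addr0 hornerZ hornerMn hornerXn.
rewrite mulr_ge0 ?mulrn_wge0 ?exprn_even_ge0 ?oddB ?(negPf dev) //.
by rewrite mulr_ge0 ?exprn_even_ge0 // divr_ge0.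
Qed.

(** The radius [a] is kept apart from |s| because both |s| itself and a fixed bound on it are
    substituted for [a]. *)
Lemma f_ge {R : realType} d (p q : R) {s a : R} : 1 <= a -> `|s| <= a ->
  2 / d%:R * p ^+ d * s ^+ d - (2 * `|p| + `|q| + 2) * a ^+ 3 <= f d p q s.
Proof.
move=> a1 sa; have a0 : 0 <= a := le_trans ler01 a1.
have Xa n : (n <= 3)%N -> `|s ^+ n| <= a ^+ 3.
  move=> n3; rewrite normrX; apply: (@le_trans _ _ (a ^+ n)).
    by rewrite lerXn2r ?nnegrE.
  by rewrite ler_weXn2l.
have h k n : (n <= 3)%N -> `|k * s ^+ n| <= `|k| * a ^+ 3.
  by move=> n3; rewrite normrM ler_wpM2l // Xa.
have := h (2 * p) 3%N isT; have := h q 2%N isT; have := h 2 1%N isT.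
rewrite !ler_norml normrM !(ger0_norm (ler0n R 2)) expr1 /f.
move=> /andP[h1 _] /andP[_ h2] /andP[h3 _]; lra.
Qed.

(** The constants [c] and [K] are free so that one bound can serve a whole range of [p] and [q]. *)
Lemma f_ge_quartic {R : realType} {d} {p q s c K : R} :
  ~~ odd d -> (4 <= d)%N -> 0 < c -> c <= 2 / d%:R * p ^+ d ->
  2 * `|p| + `|q| + 2 <= K -> 1 <= `|s| ->
  (c * `|s| - K) * `|s| ^+ 3 <= f d p q s.
Proof.
move=> dev d4 c0 cp pK s1; apply: le_trans (f_ge d p q s1 (lexx _)).
have -> : s ^+ d = `|s| ^+ d by rewrite -normrX ger0_norm // exprn_even_ge0.
rewrite mulrBl -[c * _ * _]mulrA -exprS; apply: lerB.
  apply: ler_pM => //; first exact: ltW.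
  by rewrite ler_weXn2l.
by rewrite ler_wpM2r // exprn_ge0.
Qed.

Lemma f_large {R : realType} {d} {p : R} (q r : R) :
  ~~ odd d -> (4 <= d)%N -> p != 0 ->
  exists M, forall s, M <= `|s| -> r <= f d p q s.
Proof.
move=> dev d4 p0.
set K := 2 * `|p| + `|q| + 2; set c := 2 / d%:R * p ^+ d.
have c0 : 0 < c.
  rewrite mulr_gt0 ?divr_gt0 ?ltr0n ?(leq_trans _ d4) //.
  by rewrite lt0r expf_neq0 //= exprn_even_ge0.
(* The quotient makes c |s| - K at least |r|; the summand 1 gives |s| >= 1. *)
exists (1 + (K + `|r|) / c) => s Ms.
have K0 : 0 <= K by rewrite !addr_ge0 // mulr_ge0.
have s1 : 1 <= `|s|.
  by apply: le_trans Ms; rewrite lerDl divr_ge0 ?addr_ge0 ?(ltW c0) ?normr_ge0.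
apply: le_trans (f_ge_quartic dev d4 c0 (lexx _) (lexx K) s1).
apply: (le_trans (ler_norm r)).
have cs : `|r| <= c * `|s| - K.
  rewrite lerBrDr addrC -ler_pdivrMl // mulrC; apply: le_trans Ms.
  by rewrite lerDr.
by apply: (le_trans cs); rewrite ler_peMr ?exprn_ege1 // (le_trans _ cs).
Qed.

Lemma f_continuous {R : realType} d (p q : R) : continuous (f d p q).
Proof.
have -> : f d p q = horner (fpoly d p q).
  by apply/funext => s; rewrite horner_fpoly.
exact: continuous_horner.
Qed.

Lemma deriv_at_min {R : realType} {F : {poly R}} {m : R} :
  (forall x, F.[m] <= F.[x]) -> F^`().[m] = 0.
Proof.
move=> Fm; rewrite derivE derive1E.
have m1 : m - 1 <= m + 1 by lra.
have mI : m \in `]m - 1, m + 1[ by rewrite in_itv /=; apply/andP; split; lra.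
by have [] := derive1_at_min m1 (fun t _ => @derivable_horner _ F t) mI
  (fun t _ => Fm t).
Qed.

Lemma f_attains {R : realType} {d} {p q : R} {a b r : R} :
  a <= b -> (f d p q a <= r <= f d p q b) || (f d p q b <= r <= f d p q a) ->
  exists s, a <= s <= b /\ f d p q s = r.
Proof.
move=> ab rab; have [||s] := @IVT _ (f d p q) a b r ab.
- by apply: continuous_subspaceT => t; exact: f_continuous.
- by case/orP: rab => /andP[h1 h2]; rewrite ge_min le_max h1 h2 ?orbT.
by rewrite in_itv /=; exists s.
Qed.

(* If [f] took the value [r] only at critical points, there would be such a
   point on each side of a minimiser [m], so [f'] would have the three zeros
   a < m < b; as the fourth derivative of [f] is nonnegative, [f] would then
   increase from [a] to [m]. *)
Lemma noncritical_solution {R : realType} {d} {p : R} (q r : R) :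
  ~~ odd d -> (4 <= d)%N -> p != 0 -> beta d p q < r ->
  exists s, f d p q s = r /\
    1 - q * s + 3 * p * s ^+ 2 + p ^+ d * s ^+ d.-1 != 0.
Proof.
move=> dev d4 p0 br; have d0 : (0 < d)%N by rewrite (leq_trans _ d4).
have [[m fm] fmin] := beta_min q d4 dev p0.
have [M fM] := f_large q r dev d4 p0.
have Mm : M <= `|M| := ler_norm M.
(* The interval [-u, u] contains [m], and at both ends [f] is at least [r]. *)
pose u := `|m| + `|M|.
have mu : - u <= m <= u.
  by rewrite -ler_norml /u lerDl.
have [a [/andP[_ am] fa]] : exists a, - u <= a <= m /\ f d p q a = r.
  apply: f_attains; first by case/andP: mu.
  rewrite fm (ltW br) /= fM ?orbT // normrN /u.
  by rewrite (le_trans Mm) // (le_trans _ (ler_norm _)) // lerDr.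
have [b [/andP[mb _] fb]] : exists b, m <= b <= u /\ f d p q b = r.
  apply: f_attains; first by case/andP: mu.
  rewrite fm (ltW br) /= fM // /u.
  by rewrite (le_trans Mm) // (le_trans _ (ler_norm _)) // lerDr.
have {}am : a < m.
  by rewrite lt_neqAle am andbT; apply: contraTneq br => e; rewrite -fa e fm ltxx.
have {}mb : m < b.
  by rewrite lt_neqAle mb andbT; apply: contraTneq br => e; rewrite -fb -e fm ltxx.
set g := fun s => 1 - q * s + 3 * p * s ^+ 2 + p ^+ d * s ^+ d.-1.
have [ga|ga] := eqVneq (g a) 0; last by exists a.
have [gb|gb] := eqVneq (g b) 0; last by exists b.
have Fg s : (fpoly d p q)^`().[s] = 2 * g s by rewrite horner_deriv_fpoly.
have Fm : (fpoly d p q)^`().[m] = 0.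
  by apply: deriv_at_min => x; rewrite !horner_fpoly fm.
have F4 x := derivn4_fpoly_ge0 d p q x dev d4.
have := critical_triple_le (fpoly d p q) F4 am mb.
rewrite !horner_fpoly fa fm !Fg -[2 * g m]Fg Fm ga gb mulr0 leNgt br.
by move=> /(_ erefl erefl erefl).
Qed.

(** * Fibres over p <> 0 *)

(* The fibre is parametrised by s = x / A: then p s = x B, and 1 / A is half of
   the derivative of [f] at [s]. *)
Lemma G_param {R : realType} {d} (x y z : R) : (2 <= d)%N -> polyA x y != 0 ->
  let p := Defs.polyP x y z in let s := x / polyA x y in
  let q := y + 3 * p * s + p ^+ d * s ^+ (d - 2) in
  G d (x, y, z) = (p, q, f d p q s) /\
  1 - q * s + 3 * p * s ^+ 2 + p ^+ d * s ^+ d.-1 = (polyA x y)^-1.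
Proof.
(* With d = k + 2 the truncated subtraction d - 2 becomes k. *)
case: d => [|[|k]] // _ A0 p s q.
have dn0 : k.+2%:R != 0 :> R by rewrite pnatr_eq0.
have ps : p * s = x * polyB x y z.
  by rewrite /p /s /Defs.polyP mulrC mulrA divfK.
have E : p ^+ k.+2 * s ^+ k = p ^+ 2 * (x * polyB x y z) ^+ k.
  by rewrite -ps [(p * s) ^+ k]exprMn mulrA -exprD add2n.
have E2 : (x * polyB x y z) ^+ k.+2 = p ^+ k.+2 * s ^+ k * s ^+ 2.
  by rewrite -ps [LHS]exprMn -mulrA -exprD addn2.
have K2 : (k.+2 - 2 = k)%N by rewrite subn2.
have qE : q = y + 3 * p * s + p ^+ k.+2 * s ^+ k by rewrite /q K2.
have hA : polyA x y = 1 + x * y by [].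
split; last first.
  rewrite /= [s ^+ k.+1]exprSr [p ^+ _ * (_ * s)]mulrA qE.
  set T := p ^+ k.+2 * s ^+ k.
  by rewrite /s hA; rewrite hA in A0; field.
rewrite /G; congr (_, _, _).
  rewrite /polyQd /polyQ K2 qE E [(x * _) ^+ k]exprMn.
  rewrite -[3 * p * s]mulrA ps /p /Defs.polyP -[k.+2]add2n [_ ^+ (2 + k)]exprD.
  move: (x ^+ k) (polyB x y z ^+ k) => u v; ring.
have fE : f k.+2 p q s = 2 / k.+2%:R * (p ^+ k.+2 * s ^+ k * s ^+ 2) +
    2 * p * s ^+ 3 - q * s ^+ 2 + 2 * s.
  by rewrite /f -mulrA -(mulrA _ _ (s ^+ 2)) -exprD addn2.
rewrite fE /polyRd -mulrA -exprMn E2 qE.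
(* Once d and p^d s^(d-2) are abstracted, no symbolic exponent is left for [field]. *)
move: (k.+2%:R : R) dn0 (p ^+ k.+2 * s ^+ k) => D dn0 T.
rewrite /s /p /Defs.polyP /polyR /polyB hA; rewrite hA in A0.
by field; rewrite dn0 A0.
Qed.

Lemma fibre_critical {R : realType} {d} {p : R} (q r : R) : (2 <= d)%N -> p != 0 ->
  (G d @^-1` [set (p, q, r)] !=set0 <->
   exists s, f d p q s = r /\
     1 - q * s + 3 * p * s ^+ 2 + p ^+ d * s ^+ d.-1 != 0).
Proof.
move=> d2 p0; split.
  move=> [[[x y] z]] /= Exyz.
  have A0 : polyA x y != 0.
    apply: contraNneq p0 => A0; case: Exyz => <- _ _.
    by rewrite /Defs.polyP A0 mul0r.
  have [] := G_param x y z d2 A0; rewrite [LHS]Exyz => -[<- <- ->] gE.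
  by exists (x / polyA x y); rewrite gE invr_eq0.
move=> [s [fs]]; set w := (X in X != 0) => w0.
(* The formula for q is solved for y, then A = 1 / w for x, and A B = p for z. *)
pose y := q - 3 * p * s - p ^+ d * s ^+ (d - 2).
have wE : w = 1 - s * y.
  have -> : w = 1 - q * s + 3 * p * s ^+ 2 + p ^+ d * s ^+ (d - 2) * s.
    rewrite /w -[p ^+ d * _ * s]mulrA -exprSr; congr (_ + _ * s ^+ _).
    by rewrite -subSn // subSS subn1.
  by rewrite /y; ring.
pose x := s / w.
pose z := (p * w - y ^+ 2 * (4 + 3 * x * y)) * w ^+ 2.
have AE : polyA x y = w^-1.
  by rewrite /polyA /x; move: w0; rewrite wE => w0; field.
have A0 : polyA x y != 0 by rewrite AE invr_eq0.
have PE : Defs.polyP x y z = p.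
  rewrite /Defs.polyP /polyB AE /z; move: w0; set w' := w => w0; field.
  exact: w0.
have sE : x / polyA x y = s by rewrite AE invrK /x divfK.
have [] := G_param x y z d2 A0; rewrite PE sE => GE _.
have qE : y + 3 * p * s + p ^+ d * s ^+ (d - 2) = q by rewrite /y; ring.
by exists (x, y, z); rewrite /= -[LHS]/(G d (x, y, z)) GE qE fs.
Qed.

Lemma fibre_nonempty {R : realType} {d} {p : R} (q r : R) :
  (4 <= d)%N -> ~~ odd d -> p != 0 ->
  (G d @^-1` [set (p, q, r)] !=set0 <-> beta d p q < r).
Proof.
move=> d4 dev p0; have d2 : (2 <= d)%N by rewrite (leq_trans _ d4).
have d0 : (0 < d)%N by rewrite (leq_trans _ d4).
rewrite fibre_critical //; split; last exact: noncritical_solution.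
move=> [s [fs gs]]; have [_ fmin] := beta_min q d4 dev p0.
rewrite lt_neqAle -fs fmin andbT; apply: contra_neq gs => bs.
have : (fpoly d p q)^`().[s] = 0.
  by apply: deriv_at_min => x; rewrite !horner_fpoly -bs.
by rewrite horner_deriv_fpoly // => /eqP; rewrite mulf_eq0 pnatr_eq0 /= => /eqP.
Qed.

(** * The plane p = 0 and the whole image *)

(** For q <> 0 take A = 0, i.e. x y = -1: then B = y^2 and Q_d = -2 y, which fixes y = -q / 2, and
    R_d is affine in z with slope -x^3. For q = 0 the choice y = z = 0 gives B = 0 and R_d = 2 x. *)
Lemma range_G_p0 {R : realType} {d} (q r : R) : (1 <= d)%N ->
  range (G d) (0, q, r).
Proof.
move=> d0; have [->|q0] := eqVneq q 0.
  exists (r / 2, 0, 0) => //; rewrite /G /polyRd /polyQd /Defs.polyP /polyR /polyQ.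
  have -> : polyB (r / 2) 0 0 = 0 by rewrite /polyB; ring.
  rewrite (expr0n _ d) (gtn_eqF d0) !mulr0; congr (_, _, _); first by ring.
  by field.
pose x := 2 / q; pose y := - q / 2.
pose z := (5 * x - r - (d%:R - 2) / d%:R * x ^+ d * (y ^+ 2) ^+ d) / x ^+ 3.
have A0 : polyA x y = 0 by rewrite /polyA /x /y; field.
have BE : polyB x y z = y ^+ 2.
  rewrite /polyB A0 -[3 * x * y]mulrA.
  have -> : x * y = -1 by rewrite /x /y; field.
  by ring.
exists (x, y, z) => //; rewrite /G /polyRd /polyQd /Defs.polyP /polyR /polyQ.
rewrite BE A0 mul0r expr0n /= !mul0r; congr (_, _, _).
  by rewrite /x /y; field.
have x0 : x != 0 by rewrite mulf_neq0 ?invr_eq0 ?pnatr_eq0.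
rewrite /z; set T := (d%:R - 2) / _ * _ * _.
rewrite -[3 * x ^+ 2 * y]mulrA.
have -> : x ^+ 2 * y = - x by rewrite /x /y; field.
by rewrite [x ^+ 3 * _]mulrC divfK ?expf_neq0 //; ring.
Qed.

Lemma range_G_iff {R : realType} {d} (p q r : R) : (4 <= d)%N -> ~~ odd d ->
  range (G d) (p, q, r) <-> p = 0 \/ p != 0 /\ beta d p q < r.
Proof.
move=> d4 dev; have d0 : (0 < d)%N by rewrite (leq_trans _ d4).
have [->|p0] := eqVneq p 0; first by split=> [_|_]; [left|exact: range_G_p0].
rewrite -(fibre_nonempty q r d4 dev p0); split.
  by move=> [v _ Gv]; right; split=> //; exists v.
by case=> [/eqP|[_ [v Gv]]]; [rewrite (negPf p0)|exists v].
Qed.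

(** * Openness of the image *)

(** For fixed [s] the bound on [r] is an open condition on (p, q, r), and it covers p = 0 as
    well. *)
Lemma range_G_gt_f {R : realType} {d} {p q r : R} (s : R) :
  (4 <= d)%N -> ~~ odd d -> f d p q s < r -> range (G d) (p, q, r).
Proof.
move=> d4 dev fr; apply/range_G_iff => //.
have [->|p0] := eqVneq p 0; [by left|right; split=> //].
by apply: le_lt_trans fr; have [_] := beta_min q d4 dev p0.
Qed.

(* As [p] tends to [0], [f] tends to minus infinity at [s = - k / p] for [k]
   large compared with [q]; so every [(p, q, r)] with [p] small is attained. *)
Lemma nbhs_range_G_p0 {R : realType} {d} (q r : R) :
  (4 <= d)%N -> ~~ odd d -> nbhs (0, q, r) (range (@G R d)).
Proof.
move=> d4 dev; have d0 : (0 < d)%N by rewrite (leq_trans _ d4).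
(* The leading term of [f] at -k / p' equals [C]. The choice of [k] gives 2 k + q' >= k whenever |q
   - q'| < 1, and [N], a lower bound for 1 / |p'|, absorbs C - r. *)
pose k := `|q| + 2; pose C := 2 / d%:R * k ^+ d; pose N := 4 + `|C - r|.
have k2 : 2 <= k by rewrite lerDr.
have N4 : 4 <= N by rewrite lerDl.
have N0 : 0 < N by rewrite (lt_le_trans _ N4).
have CN : C - r + 4 <= N by rewrite /N addrC lerD2l ler_norm.
apply/nbhs_ballP; exists N^-1; first by rewrite /= invr_gt0.
move=> [[p' q'] r'] [[/= hp hq] hr].
have N1 : N^-1 <= 1 by rewrite invf_le1 //; lra.
move: hp hq hr; rewrite /ball /= sub0r normrN => hp hq hr.
have {}hq : `|q - q'| < 1 by exact: lt_le_trans N1.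
have {}hr : `|r - r'| < 1 by exact: lt_le_trans N1.
have [->|p0] := eqVneq p' 0; first exact: range_G_p0.
apply: (range_G_gt_f (- k / p')) => //.
set u := `|p'|^-1.
have Nu : N < u by rewrite /u -(invrK N) ltf_pV2 ?posrE ?invr_gt0 ?normr_gt0.
have E1 : p' ^+ d * (- k / p') ^+ d = k ^+ d.
  by rewrite -exprMn mulrC divfK // exprNn -signr_odd (negPf dev) mul1r.
have u2 : u ^+ 2 = (p' ^+ 2)^-1.
  by rewrite /u exprVn -normrX ger0_norm // exprn_even_ge0.
have E : f d p' q' (- k / p') =
    C - (2 * k + q') * k ^+ 2 * u ^+ 2 - 2 * k / p'.
  rewrite /f -mulrA E1 -/C u2; by field.
have hk : - (2 * k / p') <= 2 * k * u.
  apply: le_trans (ler_norm _) _; rewrite normrN normrM normfV -/u.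
  by rewrite ger0_norm //; lra.
have q'k : k <= 2 * k + q'.
  move: hq; rewrite ltr_norml => /andP[_ hq].
  have := ler_norm (- q); rewrite normrN /k; lra.
have h3 : k * k ^+ 2 * u ^+ 2 <= (2 * k + q') * k ^+ 2 * u ^+ 2.
  have h2 : 0 <= k ^+ 2 * u ^+ 2 by rewrite mulr_ge0 ?sqr_ge0.
  by have := ler_wpM2r h2 q'k; lra.
rewrite E; move: hr; rewrite ltr_norml => /andP[_ hr].
have u0 : 4 <= u by lra.
have kk : 4 <= k ^+ 2 by rewrite expr2; nra.
have ku : u <= k * u by rewrite ler_peMl //; lra.
have kku : 4 * 4 <= k ^+ 2 * u by rewrite ler_pM.
(* Here f <= C - k u (k^2 u - 2), and the product is at least u > N >= C - r + 4, so [f] lies below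
   r - 4 < r'. *)
have : k * u <= k * u * (k ^+ 2 * u - 2) by rewrite ler_peMr //; lra.
lra.
Qed.

Lemma open_range_G {R : realType} {d} : (4 <= d)%N -> ~~ odd d ->
  open (range (@G R d)).
Proof.
move=> d4 dev; rewrite openE => -[[p q] r] /(range_G_iff _ _ _ d4 dev).
case=> [->|[p0]]; first exact: nbhs_range_G_p0.
have [[s <-] _] := beta_min q d4 dev p0 => fr.
(* The minimiser [s] for (p, q) stays fixed while the point varies, so h > 0 is an open
   condition. *)
pose h := fun v : R * R * R => v.2 - f d v.1.1 v.1.2 s.
have ch : continuous h.
  move=> v; apply: cvgB; first exact: cvg_snd.
  have c1 : w.1.1 @[w --> v] --> v.1.1.
    by apply: (@cvg_comp _ _ _ fst fst _ (nbhs v.1)); exact: cvg_fst.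
  have c2 : w.1.2 @[w --> v] --> v.1.2.
    apply: (@cvg_comp _ _ _ fst snd _ (nbhs v.1)); first exact: cvg_fst.
    exact: cvg_snd.
  apply: cvgD; last exact: cvg_cst.
  apply: cvgB; last by apply: cvgM; [|exact: cvg_cst].
  apply: cvgD; apply: cvgM; try exact: cvg_cst.
    apply: cvgM; first exact: cvg_cst.
    exact: (cvg_comp _ _ c1 (@exprn_continuous R d v.1.1)).
  by apply: cvgM; first exact: cvg_cst.
have : \forall v \near (p, q, r), 0 < h v.
  by apply: (cvgr_gt _ (ch (p, q, r))); rewrite subr_gt0.
apply: filterS => -[[p' q'] r']; rewrite /h /= subr_gt0.
exact: range_G_gt_f.
Qed.

(** * The complement of the image *)

(** The bound is uniform over a box of (p, q), so that an open box fits below the graph of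
    [beta]. *)
Lemma f_ge_unif {R : realType} {d} {p q s : R} : (4 <= d)%N -> ~~ odd d ->
  1 <= p <= 2 -> `|q| <= 1 -> - (7 * (1 + 7 * d%:R / 2) ^+ 3) <= f d p q s.
Proof.
move=> d4 dev /andP[p1 p2] q1.
have d0 : 0 < d%:R :> R by rewrite ltr0n (leq_trans _ d4).
(* On the box 2 |p| + |q| + 2 <= 7, and 2 M / d = 2 / d + 7 makes the quartic bound nonnegative
   beyond [M]. *)
set M := 1 + _; have M1 : 1 <= M by rewrite lerDl divr_ge0 // mulr_ge0.
have pa : `|p| = p by rewrite ger0_norm //; lra.
have K7 : 2 * `|p| + `|q| + 2 <= 7 by rewrite pa; lra.
have [sM|Ms] := leP `|s| M.
  apply: le_trans (f_ge d p q M1 sM).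
  have : 0 <= 2 / d%:R * p ^+ d * s ^+ d.
    by rewrite !mulr_ge0 ?exprn_even_ge0 // invr_ge0 ltW.
  have : (2 * `|p| + `|q| + 2) * M ^+ 3 <= 7 * M ^+ 3.
    by rewrite ler_wpM2r // exprn_ge0 // (le_trans _ M1).
  lra.
have c0 : 0 < 2 / d%:R :> R by rewrite divr_gt0.
have cp : 2 / d%:R <= 2 / d%:R * p ^+ d.
  by rewrite ler_peMr ?(ltW c0) // exprn_ege1.
have s1 : 1 <= `|s| by rewrite (le_trans M1) // ltW.
apply: le_trans (f_ge_quartic dev d4 c0 cp K7 s1).
apply: (@le_trans _ _ 0).
  by rewrite oppr_le0 mulr_ge0 // exprn_ge0 // (le_trans _ M1).
rewrite mulr_ge0 ?exprn_ge0 // subr_ge0.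
have : 2 / d%:R * M <= 2 / d%:R * `|s| by rewrite ler_pM2l // ltW.
apply: le_trans; rewrite /M mulrDr.
have -> : 2 / d%:R * (7 * d%:R / 2) = 7 :> R by field; rewrite gt_eqF.
by rewrite mulr1 lerDr ltW.
Qed.

Lemma ThetaE {R : realType} {d} : (4 <= d)%N -> ~~ odd d ->
  @Theta R d =
    [set v : R * R * R | let: (p, q, r) := v in p != 0 /\ r <= beta d p q].
Proof.
move=> d4 dev; apply/seteqP; split=> -[[p q] r] /=.
  move=> nG; have [p0|p0] := eqVneq p 0.
    by case: nG; apply/range_G_iff => //; left.
  split=> //; rewrite leNgt; apply/negP => br.
  by apply: nG; apply/range_G_iff => //; right.
move=> [p0 rb] /(range_G_iff _ _ _ d4 dev) [p00|[_]].
  by rewrite p00 eqxx in p0.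
by rewrite ltNge rb.
Qed.

Lemma Theta_interior {R : realType} {d} : (4 <= d)%N -> ~~ odd d ->
  (@Theta R d)° !=set0.
Proof.
move=> d4 dev; pose m : R := - (7 * (1 + 7 * d%:R / 2) ^+ 3).
(* Radius 1/2 around this centre keeps 1 <= p <= 2, |q| <= 1 and r < m. *)
exists (3 / 2, 0, m - 1); apply/nbhs_ballP; exists (1 / 2) => /=; first by lra.
move=> [[p q] r] [[/= hp hq] hr].
move: hp hq hr; rewrite /ball /= sub0r normrN !ltr_norml.
move=> /andP[hp1 hp2] /andP[hq1 hq2] /andP[hr1 hr2].
have p0 : p != 0 by rewrite gt_eqF //; lra.
rewrite ThetaE //=; split=> //.
have [[s <-] _] := beta_min q d4 dev p0.
have : m <= f d p q s.
  apply: f_ge_unif => //; first by apply/andP; split; lra.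
  by rewrite ler_norml; apply/andP; split; lra.
lra.
Qed.

Lemma Theta_unbounded {R : realType} {d} : (4 <= d)%N -> ~~ odd d ->
  ~ bounded_set (@Theta R d).
Proof.
move=> d4 dev [M [_ hM]].
(* Over (1, 0) a point of the downward ray is taken so low that its norm exceeds |M| + 1. *)
pose r : R := Num.min (beta d 1 0) (- (`|M| + 2)).
have rT : Theta d (1, 0, r).
  by rewrite ThetaE //=; split; rewrite ?oner_neq0 // ge_min lexx.
have := hM (`|M| + 1) _ _ rT.
have M1 : M < `|M| + 1 by rewrite ltr_pwDr // ler_norm.
move=> /(_ M1); rewrite /= !prod_normE /= !ge_max => /andP[_].
have : r <= - (`|M| + 2) by rewrite ge_min lexx orbT.
have := ler_norm (- r); rewrite normrN; lra.
Qed.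

Theorem proposition7 (R : realType) (d : nat) (hd4 : (4 <= d)%N)
    (hdeven : ~~ odd d) :
  (forall p q r : R, p != 0 ->
     (G d @^-1` [set (p, q, r)] !=set0 <-> beta d p q < r)) /\
  range (@G R d) =
    [set v : R * R * R | let: (p, _, _) := v in p = 0] `|`
    [set v : R * R * R | let: (p, q, r) := v in p != 0 /\ beta d p q < r] /\
  @Theta R d =
    [set v : R * R * R | let: (p, q, r) := v in p != 0 /\ r <= beta d p q] /\
  ~ bounded_set (@Theta R d) /\
  (@Theta R d)° !=set0 /\
  (forall p q : R, p != 0 ->
     exists r0 : R, [set (p, q, r) | r in [set r : R | r <= r0]] `<=` Theta d) /\
  closed (@Theta R d).
Proof.
split; first by move=> p q r; exact: fibre_nonempty.
split.
  by apply/seteqP; split=> -[[p q] r] h; apply/range_G_iff.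
split; first exact: ThetaE.
split; first exact: Theta_unbounded.
split; first exact: Theta_interior.
split; last by apply: open_closedC; exact: open_range_G.
move=> p q p0; exists (beta d p q) => _ [r rb <-].
by rewrite ThetaE.
Qed.
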